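(* Let $(C_i)_{i\ge1}$ be an enumeration of the tuatara machines, and define the Turing machine $W$ by $W(0^i1x)=C_i(x)$ for all $i\ge1$ and $x\in\Sigma^*$ (with $W$ undefined on all other inputs). Then $W$ is a universal tuatara machine.
   Context: Turing machines map binary strings to binary strings (partial functions on $\Sigma^*$, $\Sigma=\{0,1\}$); $\mathrm{dom}(M)$ is the set of inputs on which $M$ halts. $\mathrm{bin}:\mathbf{N}=\{1,2,\dots\}\to\Sigma^*$ is the bijection sending $n$ to its binary expansion with the leading 1 removed. $\zeta_M=\sum_{n\ge1,\ \mathrm{bin}(n)\in\mathrm{dom}(M)}\frac1n$; $M$ is a tuatara machine if $\zeta_M\le1$. A Turing machine $W$ is universal for a class $\Re$ of Turing machines if for every $C\in\Re$ there is a constant $c\ge0$ such that for every $x\in\mathrm{dom}(C)$ there is $p_x\in\mathrm{dom}(W)$ with $|p_x|\le|x|+c$ and $W(p_x)=C(x)$. A universal tuatara machine is a tuatara machine universal for the class of tuatara machines. *)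

(* Defs.v *)
From mathcomp Require Import all_boot all_order all_algebra.
From mathcomp Require Import all_classical all_reals all_analysis.

Set Implicit Arguments.
Unset Strict Implicit.
Unset Printing Implicit Defensive.

Import Order.TTheory GRing.Theory Num.Theory.

Local Open Scope classical_set_scope.
Local Open Scope ereal_scope.

(* Deterministic Turing machines with one two-way infinite tape.  A tape symbol
   is a blank (None), a bit, or one of finitely many auxiliary symbols; the
   machine halts when no transition applies. *)
Inductive direction := MoveLeft | MoveRight | Stay.

Record machine := Machine {
  state : finType;
  aux : finType;
  start : state;
  trans : state -> option (bool + aux) ->
          option (state * option (bool + aux) * direction) }.

Definition symbol (M : machine) : Type := option (bool + aux M).

Definition blank (M : machine) : symbol M := None.

Definition bit (M : machine) (b : bool) : symbol M := Some (inl b).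

(* [tleft] lists the cells to the left of the head, nearest first; [tright]
   lists the scanned cell and the cells to its right.  All cells beyond the two
   lists are blank. *)
Record config (M : machine) := Config {
  cstate : state M;
  tleft : seq (symbol M);
  tright : seq (symbol M) }.

Definition step (M : machine) (c : config M) : option (config M) :=
  let: Config q l r := c in
  match trans q (head (blank M) r) with
  | None => None
  | Some (q', a, MoveLeft) =>
      Some (Config q' (behead l) (head (blank M) l :: a :: behead r))
  | Some (q', a, MoveRight) => Some (Config q' (a :: l) (behead r))
  | Some (q', a, Stay) => Some (Config q' l (a :: behead r))
  end.

Definition steps (M : machine) (n : nat) (c : config M) : config M :=
  iter n (fun c' => odflt c' (step c')) c.

(* The output is read from the scanned cell rightwards, up to the first cell
   that does not contain a bit. *)
Fixpoint leading_bits (M : machine) (r : seq (symbol M)) : seq bool :=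
  match r with
  | Some (inl b) :: r' => b :: leading_bits r'
  | _ => [::]
  end.

Definition computes (M : machine) (w : seq (symbol M)) (y : seq bool) : Prop :=
  exists n : nat, let c := steps n (Config (start M) [::] w) in
    step c = None /\ leading_bits (tright c) = y.

Definition outputs (M : machine) (x y : seq bool) : Prop :=
  computes (map (@bit M) x) y.

(* Two-argument input (i, x): i in unary, then a blank, then x. *)
Definition outputs2 (M : machine) (i : nat) (x y : seq bool) : Prop :=
  computes (map (@bit M) (nseq i false) ++ blank M :: map (@bit M) x) y.

Definition dom (M : machine) : set (seq bool) :=
  [set x | exists y, outputs M x y].

(* M(x) = N(y) as values of partial functions: both undefined, or both defined
   and equal. *)
Definition same_value (M : machine) (x : seq bool) (N : machine) (y : seq bool)
  : Prop := forall z, outputs M x z <-> outputs N y z.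

(* The binary digits of n, from weight 2^(floor (log2 n) - 1) down to weight 1:
   all of them but the leading 1 when n >= 1.  The value at 0 is irrelevant. *)
Definition bin (n : nat) : seq bool :=
  [seq odd (n %/ 2 ^ k)%N | k <- rev (iota 0 (trunc_log 2 n))].

Definition zeta (R : realType) (M : machine) : \bar R :=
  \sum_(1 <= n <oo | bin n \in dom M) (n%:R^-1)%:E.

Definition tuatara (R : realType) (M : machine) : Prop := zeta R M <= 1.

Definition universal_for (Re : machine -> Prop) (W : machine) : Prop :=
  forall C, Re C -> exists c : nat, forall x, dom C x ->
    exists p, [/\ dom W p, (size p <= size x + c)%N & same_value W p C x].

Definition universal_tuatara (R : realType) (W : machine) : Prop :=
  tuatara R W /\ universal_for (tuatara R) W.

(* An enumeration (C_i)_(i >= 1), the entry C 0 being ignored, is effective: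
   (i, x) |-> C_i(x) is partial computable.  Machines are listed up to equality
   of the partial functions they compute. *)
Definition enumeration (Re : machine -> Prop) (C : nat -> machine) : Prop :=
  [/\ exists U : machine, forall i x y, (0 < i)%N ->
        outputs2 U i x y <-> outputs (C i) x y,
      forall i, (0 < i)%N -> Re (C i) &
      forall M, Re M ->
        exists2 i, (0 < i)%N & forall x, same_value M x (C i) x].

(* W(0^i 1 x) = C_i(x) for all i >= 1 and all x; W is undefined elsewhere. *)
Definition is_join (C : nat -> machine) (W : machine) : Prop :=
  (forall i x, (0 < i)%N ->
     same_value W (nseq i false ++ true :: x) (C i) x) /\
  (forall s, (forall i x, (0 < i)%N -> s <> nseq i false ++ true :: x) ->
     ~ dom W s).

(* Main.v *)
(* Write [n(x)] for the number with [bin (n x) = x].  Since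
   [n(x) < 2^(|x|+1)], prefixing 0^i 1 multiplies the number by at least 2^i:
   [n(0^i 1 x) = 2^(i+1+|x|) + n(x) >= 2^i n(x)].  Hence
   zeta_W <= sum_i 2^-i zeta_{C_i} <= 1, which is checked on partial sums.
   Universality is immediate, with constant i + 1 for the machine C_i.
   To build W from a machine U computing (i, x) |-> C_i(x): check that the input
   starts with 0^i 1, i >= 1, overwrite that 1 by a blank, return to the first
   cell and run U; on any other input the check loops forever. *)
Require Import Defs.
From mathcomp Require Import all_boot all_order all_algebra.
From mathcomp Require Import all_classical all_reals all_analysis.
From mathcomp Require Import zify ring.

Set Implicit Arguments.
Unset Strict Implicit.
Unset Printing Implicit Defensive.

Import Order.TTheory GRing.Theory Num.Theory.

(** * Runs from an arbitrary configuration *)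

Definition halts_with (M : machine) (c : config M) (y : seq bool) : Prop :=
  exists n : nat, step (steps n c) = None /\
    leading_bits (tright (steps n c)) = y.

Lemma stepsS (M : machine) n (c c' : config M) :
  step c = Some c' -> steps n.+1 c = steps n c'.
Proof. by move=> h; rewrite /steps iterSr h. Qed.

Lemma halts_with_step (M : machine) (c c' : config M) y :
  step c = Some c' -> halts_with c y <-> halts_with c' y.
Proof.
move=> h; split=> [[[|n]]|[n]].
- by rewrite /= h => -[].
- by rewrite (stepsS _ h) => hn; exists n.
- by move=> hn; exists n.+1; rewrite (stepsS _ h).
Qed.

(** The machine loops in place. The right list may still change once, when an implicit blank is
    written explicitly, so the invariant fixes only its head. *)
Lemma not_halts_with_stay (M : machine) q l r y :
  trans q (head (blank M) r) = Some (q, head (blank M) r, Stay) ->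
  ~ halts_with (Config q l r) y.
Proof.
move=> h [n [+ _]].
suff [r' -> hr'] : exists2 r', steps n (Config q l r) = Config q l r' &
    head (blank M) r' = head (blank M) r by rewrite /= hr' h.
elim: n => [|n [r' hn hr']]; first by exists r.
exists (head (blank M) r :: behead r') => //.
by rewrite /steps iterS -/(steps n _) hn /= hr' h.
Qed.

Lemma nseq_cat_cons (T : Type) n (x : T) s :
  nseq n x ++ x :: s = nseq n.+1 x ++ s.
Proof. by elim: n => //= n ->. Qed.

(** * The joined machine built from [U] *)

Section Join.

Variable U : machine.

Definition join_state : finType := (option bool + state U)%type.
Definition Start : join_state := inl None.
Definition Scan : join_state := inl (Some false).
Definition Back : join_state := inl (Some true).

(** [Start] differs from [Scan] only in rejecting a 1, which enforces i >= 1. [Back] recognises the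
    left end by the blank at cell -1. Any other symbol in a control state gives an endless loop. *)
Definition join_trans (q : join_state) (a : symbol U) :
    option (join_state * symbol U * direction) :=
  match q, a with
  | inl None, Some (inl false) => Some (Scan, a, MoveRight)
  | inl (Some false), Some (inl false) => Some (Scan, a, MoveRight)
  | inl (Some false), Some (inl true) => Some (Back, None, MoveLeft)
  | inl (Some true), Some (inl false) => Some (Back, a, MoveLeft)
  | inl (Some true), None => Some (inr (start U), a, MoveRight)
  | inl _, _ => Some (q, a, Stay)
  | inr q', _ => omap (fun t => (inr t.1.1, t.1.2, t.2)) (trans q' a)
  end.

Definition join_machine : machine :=
  @Machine join_state (aux U) Start join_trans.

(* The return trip to cell 0 visits cell -1, which leaves an explicit blank at
   the far end of the left half-tape. *)
Definition simulates (c : config U) (c' : config join_machine) : Prop :=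
  [/\ cstate c' = inr (cstate c), tright c' = tright c &
      tleft c' = tleft c \/ tleft c' = rcons (tleft c) (blank U)].

Lemma simulates_step c c' : simulates c c' ->
  match step c, step c' with
  | None, None => True
  | Some d, Some d' => simulates d d'
  | _, _ => False
  end.
Proof.
case: c => q l r; case: c' => q' l' r' [/= -> -> hl].
rewrite /blank /=; case: (trans q _) => [[[p a] []]|] //=; split=> //=.
- by case: hl => -> //; case: l.
(* Moving left from an empty left list uses up the extra blank; the two left lists then agree. *)
- by case: hl => ->; [left | case: l => [|? l]; [left | right]].
- by case: hl => ->; [left | right].
Qed.

Lemma simulates_steps n c c' :
  simulates c c' -> simulates (steps n c) (steps n c').
Proof.
move=> h; elim: n => //= n /[dup] IH /simulates_step.
by case: (step (steps n c)) (step (steps n c')) => [d|] [d'|].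
Qed.

Lemma leading_bits_join (r : seq (symbol U)) :
  @leading_bits join_machine r = leading_bits r.
Proof. by elim: r => [|[[b|a]|] r IH] //=; rewrite IH. Qed.

Lemma simulates_halts_with c c' y :
  simulates c c' -> halts_with c' y <-> halts_with c y.
Proof.
move=> h; suff E : forall n,
    (step (steps n c') = None <-> step (steps n c) = None) /\
    leading_bits (tright (steps n c')) = leading_bits (tright (steps n c)).
  by split=> -[n [hn <-]]; exists n; have [[? ?] ?] := E n; split; auto.
move=> n; have S := simulates_steps n h.
have := simulates_step S; case: S => _ -> _ hs; split; last exact: leading_bits_join.
by move: hs; case: (step (steps n c)) (step (steps n c')) => [d|] [d'|].
Qed.

Lemma halts_with_scan j l r y :
  halts_with (@Config join_machine Scan l
    (map (@bit join_machine) (nseq j false) ++ r)) y <->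
  halts_with (@Config join_machine Scan (nseq j (bit U false) ++ l) r) y.
Proof.
elim: j l => //= j IH l.
rewrite (halts_with_step (c' := @Config join_machine Scan (bit U false :: l)
    (map (@bit join_machine) (nseq j false) ++ r))) // IH.
by rewrite nseq_cat_cons.
Qed.

Lemma halts_with_back j r y :
  halts_with (@Config join_machine Back (nseq j (bit U false))
    (bit U false :: r)) y <->
  halts_with (@Config join_machine Back [::]
    (blank U :: nseq j.+1 (bit U false) ++ r)) y.
Proof.
elim: j r => [|j IH] r; first exact: halts_with_step.
rewrite (halts_with_step (c' := @Config join_machine Back
  (nseq j (bit U false)) (bit U false :: bit U false :: r))) // IH.
by rewrite (nseq_cat_cons j.+1).
Qed.

Lemma outputs_join i x y : (0 < i)%N ->
  outputs join_machine (nseq i false ++ true :: x) y <-> outputs2 U i x y.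
Proof.
case: i => // i _; rewrite /outputs map_cat /=.
rewrite -[computes _ _]/(halts_with _ y).
rewrite (halts_with_step (c' := @Config join_machine Scan [:: bit U false]
    (map (@bit join_machine) (nseq i false) ++
     map (@bit join_machine) (true :: x)))) // halts_with_scan.
rewrite nseq_cat_cons cats0.
(* The 1 becomes the blank that separates i from x in the input format of [outputs2]. *)
rewrite (halts_with_step (c' := @Config join_machine Back
    (nseq i (bit U false))
    (bit U false :: blank U :: map (@bit U) x))) // halts_with_back.
rewrite (halts_with_step (c' := @Config join_machine (inr (start U))
    [:: blank U]
    (nseq i.+1 (bit U false) ++ blank U :: map (@bit U) x))) //.
rewrite -map_nseq; apply: simulates_halts_with; split=> //; by right.
Qed.

Lemma dom_join s : dom join_machine s ->
  exists i x, (0 < i)%N /\ s = nseq i false ++ true :: x.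
Proof.
(* Strip the leading zeros. The bad inputs are those with no zero, which loop in [Start], and those
   with nothing but zeros, which loop in [Scan]. *)
have [i [r [-> hr]]] : exists i r, s = nseq i false ++ r /\
    (r = [::] \/ exists x, r = true :: x).
  elim: s => [|[] s [i [r [-> hr]]]]; first by exists 0%N, [::]; split; auto.
    by exists 0%N, (true :: nseq i false ++ r); split; eauto.
  by exists i.+1, r.
case: i hr => [|i] hr [y]; rewrite /outputs.
  by case: hr => [->|[x ->]] /=; move/not_halts_with_stay; case.
case: hr => [->|[x ->]]; last by move=> _; exists i.+1, x.
rewrite map_cat -[computes _ _]/(halts_with _ y).
rewrite (halts_with_step (c' := @Config join_machine Scan [:: bit U false]
    (map (@bit join_machine) (nseq i false) ++ [::]))) // halts_with_scan.
by move/not_halts_with_stay; case.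
Qed.

End Join.

(** * The inverse of [bin] and the index of a prefixed string *)

Definition unbin_from (a : nat) (s : seq bool) : nat :=
  foldl (fun n (b : bool) => n.*2 + b)%N a s.

(** The seed 1 restores the leading digit that [bin] drops. *)
Definition unbin : seq bool -> nat := unbin_from 1.

Lemma unbin_fromE a s : unbin_from a s = (a * 2 ^ size s + unbin_from 0 s)%N.
Proof.
rewrite /unbin_from; elim/last_ind: s => [|s b IH]; first by rewrite /= muln1 addn0.
by rewrite !foldl_rcons IH size_rcons expnS -!muln2; lia.
Qed.

Lemma unbin_from0_lt s : (unbin_from 0 s < 2 ^ size s)%N.
Proof.
rewrite /unbin_from; elim/last_ind: s => // s b IH.
by rewrite foldl_rcons size_rcons expnS; case: b; lia.
Qed.

Lemma unbin_gt0 s : (0 < unbin s)%N.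
Proof. by rewrite /unbin unbin_fromE mul1n addn_gt0 expn_gt0. Qed.

(** A new last digit shifts every weight by one place and raises [trunc_log] by one. This recursion
    drives both inversion proofs. *)
Lemma bin_rcons n (b : bool) : (0 < n)%N -> bin (n.*2 + b) = rcons (bin n) b.
Proof.
move=> n0; rewrite /bin.
have -> : trunc_log 2 (n.*2 + b) = (trunc_log 2 n).+1.
  have /andP[h1 h2] := @trunc_log_bounds 2 n isT n0.
  apply: trunc_log_eq => //; rewrite !expnS in h2 *; apply/andP; split; case: b; lia.
rewrite /= rev_cons map_rcons divn1 oddD odd_double /=.
rewrite oddb; congr rcons; rewrite -[1%N]/(1 + 0)%N iotaDl -map_rev -map_comp.
apply: eq_map => k /=; rewrite add1n expnS divnMA.
by congr (odd (_ %/ _)); case: b; lia.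
Qed.

Lemma unbinK : cancel unbin bin.
Proof.
elim/last_ind=> [//|s b IH].
rewrite /unbin /unbin_from foldl_rcons bin_rcons ?IH //; exact: unbin_gt0.
Qed.

Lemma binK n : (0 < n)%N -> unbin (bin n) = n.
Proof.
elim/ltn_ind: n => n IH n0.
have [n1|n1] := leqP n 1; first by have -> : n = 1%N by lia.
rewrite -[in LHS](odd_double_half n) addnC bin_rcons; last by lia.
rewrite /unbin /unbin_from foldl_rcons -/(unbin_from _ _) -/(unbin _) IH; lia.
Qed.

Definition join_index (i m : nat) : nat :=
  unbin (nseq i false ++ true :: bin m).

Lemma join_index_ge i m : (0 < m)%N -> (2 ^ i * m <= join_index i m)%N.
Proof.
move=> m0; rewrite -[in leqLHS](binK m0) /join_index; set x := bin m.
have E : unbin_from 1 (nseq i false) = (2 ^ i)%N.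
  elim: i => // i IH; rewrite -[i.+1]addn1 nseqD cats1 /unbin_from foldl_rcons.
  by rewrite -/(unbin_from _ _) IH addn1 expnS addn0 mul2n.
(* Reading 0^i and then 1 turns the seed 1 into 2^(i+1) + 1. What remains is a(k + v) <= (2a + 1)k +
   v, which follows from v < k. *)
have -> : unbin (nseq i false ++ true :: x) =
    unbin_from (unbin_from 1 (nseq i false)).*2.+1 x.
  by rewrite /unbin [LHS]/unbin_from foldl_cat /= addn1.
rewrite E /unbin (unbin_fromE 1) (unbin_fromE (2 ^ i).*2.+1).
have := unbin_from0_lt x; set k := (2 ^ size x)%N; set v := unbin_from 0 x.
set a := (2 ^ i)%N; nia.
Qed.

Lemma dom_is_join C W n : is_join C W -> (0 < n)%N -> dom W (bin n) ->
  exists i m, [/\ (0 < i)%N, (0 < m)%N, dom (C i) (bin m) & n = join_index i m].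
Proof.
move=> [hW1 hW2] n0 hn.
have [i [x [i0 E]]] : exists i x, (0 < i)%N /\ bin n = nseq i false ++ true :: x.
  (* [is_join] only denies halting off the form 0^i 1 x, so the form is obtained by
     contradiction. *)
  apply: contrapT => h; apply: (hW2 (bin n)) hn => i x i0 E.
  by apply: h; exists i, x.
exists i, (unbin x); split=> //; first exact: unbin_gt0.
  by rewrite unbinK; have [y] := hn; rewrite E => /(hW1 _ _ i0); exists y.
by rewrite /join_index unbinK -E binK.
Qed.

(** * Bounding zeta through partial sums *)

Local Open Scope ring_scope.

(** The terms are nonnegative, so the limit bounds every partial sum and inherits any common bound.
    Only finite real sums remain. *)
Lemma zeta_le1P (R : realType) M :
  tuatara R M <->
  forall N, \sum_(1 <= n < N | bin n \in dom M) (n%:R^-1 : R) <= 1.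
Proof.
have inv_ge0 n : (0 <= (n%:R^-1 : R)%:E)%E by rewrite lee_fin invr_ge0.
rewrite /tuatara /zeta; split=> [h N|h].
  rewrite -lee_fin -sumEFin; apply: le_trans h.
  by apply: nneseries_lim_ge => n _ _; exact: inv_ge0.
apply: lime_le; first by apply: is_cvg_nneseries_cond => n _ _; exact: inv_ge0.
by apply: nearW => N; rewrite sumEFin lee_fin.
Qed.

Lemma sum_half_pow (R : realFieldType) N :
  \sum_(1 <= i < N.+1) (2 ^- i : R) = 1 - 2 ^- N.
Proof.
elim: N => [|N IH]; first by rewrite big_nil expr0 invr1 subrr.
by rewrite big_nat_recr //= IH exprS; field; rewrite expf_neq0.
Qed.

Lemma le_sum_seq_term (R : numDomainType) (I : eqType) (r : seq I)
    (P : pred I) (F : I -> R) i :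
  uniq r -> (forall j, P j -> 0 <= F j) -> i \in r -> P i ->
  F i <= \sum_(j <- r | P j) F j.
Proof.
move=> ur F0 ir Pi; rewrite big_mkcond (bigD1_seq i) //= Pi lerDl sumr_ge0 //.
by move=> j _; case: ifP => // /F0.
Qed.

(** Only an inequality, since [i] may fall outside the truncated range. *)
Lemma sum_seq_delta_le (R : numDomainType) (I : eqType) (r : seq I)
    (F : I -> R) i : uniq r -> 0 <= F i ->
  \sum_(j <- r) (if i == j then F j else 0) <= F i.
Proof.
move=> ur Fi0; have [ir|ir] := boolP (i \in r).
  rewrite (bigD1_seq i) //= eqxx big1 ?addr0 // => j.
  by rewrite eq_sym => /negbTE ->.
rewrite big1_seq // => j /andP[_ jr].
by case: eqP => // ij; rewrite ij jr in ir.
Qed.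

Lemma tuatara_join (R : realType) C W :
  (forall i, (0 < i)%N -> tuatara R (C i)) -> is_join C W -> tuatara R W.
Proof.
move=> hC hW; apply/zeta_le1P => N.
case: N => [|N]; first by rewrite big_nil.
have inv_ge0 n : 0 <= (n%:R^-1 : R) by rewrite invr_ge0.
(* This indicator weight replaces a reindexing of the sum along [join_index]: sums over i, m and n
   can then be exchanged. *)
pose delta i m n : R := if join_index i m == n then n%:R^-1 else 0.
have delta_ge0 i m n : 0 <= delta i m n by rewrite /delta; case: ifP.
apply: (@le_trans _ _ (\sum_(1 <= n < N.+1) \sum_(1 <= i < N.+1)
    \sum_(1 <= m < N.+1 | bin m \in dom (C i)) delta i m n)).
  rewrite big_mkcond; apply: ler_sum_nat => n /andP[n0 nN].
  case: ifP => [|_]; last by do 2! (apply: sumr_ge0 => ? _).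
  rewrite inE => /(dom_is_join hW n0) [i [m [i0 m0 hm E]]].
  (* From 2^i m <= n both i and m are at most n, so one truncation serves all three indices. *)
  have := join_index_ge i m0; rewrite -E => le_n.
  have mN : m \in index_iota 1 N.+1.
    by rewrite mem_index_iota m0 (leq_ltn_trans _ nN) // (leq_trans _ le_n) //
      leq_pmull // expn_gt0.
  have iN : i \in index_iota 1 N.+1.
    rewrite mem_index_iota i0 (leq_ltn_trans _ nN) // (leq_trans _ le_n) //.
    by rewrite (leq_trans (ltnW (ltn_expl i (isT : 1 < 2)%N))) // leq_pmulr.
  have -> : n%:R^-1 = delta i m n by rewrite /delta E eqxx.
  apply: le_trans (le_sum_seq_term (iota_uniq _ _) _ iN isT) => [|j _].
    by apply: (le_sum_seq_term (iota_uniq _ _) _ mN); rewrite ?inE.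
  exact: sumr_ge0.
rewrite exchange_big /=.
apply: (@le_trans _ _ (\sum_(1 <= i < N.+1) 2 ^- i)); last first.
  by rewrite sum_half_pow gerBl invr_ge0 exprn_ge0.
apply: ler_sum_nat => i /andP[i0 _]; rewrite exchange_big /=.
(* For fixed i and m the sum over n collapses to at most 1 / [join_index i m], hence to at most 2^-i
   / m. *)
apply: (@le_trans _ _ (\sum_(1 <= m < N.+1 | bin m \in dom (C i))
    2 ^- i * m%:R^-1)).
  rewrite [leLHS]big_mkcond [leRHS]big_mkcond.
  apply: ler_sum_nat => m /andP[m0 _]; case: ifP => // _.
  apply: le_trans (sum_seq_delta_le (iota_uniq _ _) (inv_ge0 _)) _.
  rewrite -invfM lef_pV2 ?posrE ?mulr_gt0 ?exprn_gt0 ?ltr0n //; last first.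
    by rewrite (leq_trans _ (join_index_ge i m0)) // muln_gt0 expn_gt0.
  by rewrite -natrX -natrM ler_nat join_index_ge.
rewrite -mulr_sumr ler_piMr ?invr_ge0 ?exprn_ge0 //.
by have /zeta_le1P := hC i i0; apply.
Qed.

Theorem theorem25 (R : realType) (C : nat -> machine)
    (hC : enumeration (tuatara R) C) :
  (exists W : machine, is_join C W) /\
  (forall W : machine, is_join C W -> universal_tuatara R W).
Proof.
have [[U hU] hre hsurj] := hC; split.
  exists (join_machine U); split=> [i x i0 z|s hs hd].
    by rewrite outputs_join // hU.
  by have [i [x [i0 E]]] := dom_join hd; exact: (hs i x).
move=> W hW; split; first exact: tuatara_join hre hW.
move=> M /hsurj [i i0 hM]; exists i.+1 => x [y hy].
(* The enumeration contains [M] only up to the function computed, so values pass through [C i]. *)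
have hWM : same_value W (nseq i false ++ true :: x) M x.
  by move=> z; rewrite hM; exact: hW.1.
exists (nseq i false ++ true :: x); split=> //; first by exists y; apply/hWM.
by rewrite size_cat size_nseq /= addnC addSnnS.
Qed.
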